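(* Assume the $eR$-module $eV$ is free with base $y_1,\dots,y_n$. Let $y\in eV$, $y\ne0$, $Y=\mathrm{ray}(y)$, $Y_i=\mathrm{ray}(y_i)$ for $1\le i\le n$, and let $W$ be a ray in $V$. Then $$\mathrm{CS}(W,Y)\le\frac{q_{\mathrm{QL}}(y)}{q(y)}\cdot\max_{1\le i\le n}\mathrm{CS}(W,Y_i).$$
   Context: A supertropical semiring is a commutative semiring $R$ such that $e:=1+1$ satisfies $e+e=e$ and, for all $a,b\in R$: $a+b\in\{a,b\}$ if $ea\ne eb$, and $a+b=ea$ if $ea=eb$. Then $eR$ is a bipotent semiring with unit $e$, totally ordered by $a\le b\Leftrightarrow a+b=b$. Assume $eR$ is a semifield. $V$ is an $R$-module with a quadratic pair $(q,b)$: $q:V\to R$ with $q(ax)=a^2q(x)$, and $b:V\times V\to R$ symmetric bilinear with $q(x+y)=q(x)+q(y)+b(x,y)$. Assume $q$ is anisotropic: $q^{-1}(0)=\{0\}$. Rays: $x\sim x'$ in $V\setminus\{0\}$ iff $\lambda x=\mu x'$ for some $\lambda,\mu\in R\setminus\{0\}$; the classes are the rays and $\mathrm{ray}(x)$ is the class of $x$. For rays $X=\mathrm{ray}(x)$, $Y=\mathrm{ray}(y)$, $\mathrm{CS}(X,Y):=\dfrac{e\,b(x,y)^2}{e\,q(x)q(y)}\in eR$ (independent of the choice of $x\in X$, $y\in Y$). $q_{\mathrm{QL}}$ denotes the quasilinear part of $q|_{eV}$ with respect to the base: for $y=\sum_{i=1}^n\lambda_iy_i$ with $\lambda_i\in eR$,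 $q_{\mathrm{QL}}(y)=\sum_{i=1}^n\lambda_i^2q(y_i)$. (All values of $q$ and $q_{\mathrm{QL}}$ on $eV$ lie in $eR$.) *)

(* Defs.v *)
From mathcomp Require Export all_boot all_algebra.
From mathcomp Require Export boolp classical_sets.

Set Implicit Arguments.
Unset Strict Implicit.
Unset Printing Implicit Defensive.

Import GRing.Theory.
Local Open Scope classical_set_scope.
Local Open Scope ring_scope.

Section Supertropical.
Variable R : comPzSemiRingType.

Definition e_of : R := 1 + 1.
Local Notation e := e_of.

Record supertropical : Prop := Supertropical {
  st_idem : e + e = e;
  st_bipotent : forall a b : R, e * a <> e * b -> a + b = a \/ a + b = b;
  st_ghost : forall a b : R, e * a = e * b -> a + b = e * a }.

(* The ideal eR is kept as a subset of R: its unit is e, so it is not a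
   subsemiring of R in the sense of MathComp. *)
Definition eR : set R := [set e * a | a in setT].

Definition eR_semifield : Prop :=
  e <> 0 /\ forall a : R, eR a -> a <> 0 -> exists2 c : R, eR c & a * c = e.

(* The inverse in the semifield eR; meaningful for nonzero elements of eR. *)
Definition einv (a : R) : R := xget 0 [set c | eR c /\ a * c = e].
Definition ediv (a c : R) : R := a * einv c.

(* The total order of eR; only used on elements of eR. *)
Definition ele (a c : R) : bool := a + c == c.

(* 0 is the least element of eR, hence the neutral element of emax on eR. *)
Definition emax (a c : R) : R := if ele a c then c else a.

End Supertropical.

Arguments e_of : clear implicits.
Arguments supertropical : clear implicits.
Arguments eR : clear implicits.
Arguments eR_semifield : clear implicits.

Section QuadraticPair.
Variables (R : comPzSemiRingType) (V : lSemiModType R).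
Local Notation e := (e_of R).

(* Linearity of b is stated in the second argument only, the first one being
   covered by symmetry; MathComp's biscalar forms require a ring. *)
Record quadratic_pair (q : V -> R) (b : V -> V -> R) : Prop := QuadraticPair {
  qp_scale : forall (a : R) (x : V), q (a *: x) = a ^+ 2 * q x;
  qp_sym : forall x y : V, b x y = b y x;
  qp_add : forall x y z : V, b x (y + z) = b x y + b x z;
  qp_scaleb : forall (a : R) (x y : V), b x (a *: y) = a * b x y;
  qp_polar : forall x y : V, q (x + y) = q x + q y + b x y }.

Definition anisotropic (q : V -> R) : Prop := q @^-1` [set 0] = [set 0].

Definition ray (x : V) : set V :=
  [set x' | x' <> 0 /\
     exists l m : R, [/\ l <> 0, m <> 0 & l *: x = m *: x']].

Definition is_ray (X : set V) : Prop := exists2 x : V, x <> 0 & X = ray x.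

(* CS is computed on chosen representatives; see CS_ray for independence. *)
Definition CS (q : V -> R) (b : V -> V -> R) (X Y : set V) : R :=
  let x := xget 0 X in let y := xget 0 Y in
  ediv (e * b x y ^+ 2) (e * (q x * q y)).

Definition eV : set V := [set e *: v | v in setT].

Definition decomposition (n : nat) (Y : 'I_n -> V) (y : V) :
    set {ffun 'I_n -> R} :=
  [set l | (forall i, eR R (l i)) /\ y = \sum_(i < n) l i *: Y i].

Definition eV_base (n : nat) (Y : 'I_n -> V) : Prop :=
  (forall i, eV (Y i)) /\
  (forall y : V, eV y -> exists! l, decomposition Y y l).

Definition coords (n : nat) (Y : 'I_n -> V) (y : V) : {ffun 'I_n -> R} :=
  xget [ffun=> 0] (decomposition Y y).

Definition qQL (q : V -> R) (n : nat) (Y : 'I_n -> V) (y : V) : R :=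
  \sum_(i < n) coords Y y i ^+ 2 * q (Y i).

End QuadraticPair.

Section Theory.
Variables (R : comPzSemiRingType) (V : lSemiModType R).
Variables (q : V -> R) (b : V -> V -> R).
Local Notation e := (e_of R).

Hypothesis stR : supertropical R.
Hypothesis sfR : eR_semifield R.
Hypothesis qb : quadratic_pair q b.
Hypothesis qan : anisotropic q.

Lemma mulee : e * e = e.
Proof. by rewrite {1}/e_of mulrDl mul1r (st_idem stR). Qed.

Lemma eR_mule (a : R) : eR R (e * a). Proof. by exists a. Qed.

Lemma eR_id (a : R) : eR R a -> e * a = a.
Proof. by case=> c _ <-; rewrite mulrA mulee. Qed.

Lemma e_eq0 (a : R) : e * a = 0 -> a = 0.
Proof.
move=> ea0; have: e * a = e * 0 by rewrite mulr0.
by move/(st_ghost stR); rewrite addr0 ea0.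
Qed.

Lemma einvP (a : R) : eR R a -> a <> 0 -> eR R (einv a) /\ a * einv a = e.
Proof.
move=> aR a0; have [c cR ac] := sfR.2 a aR a0.
by apply: (@xgetPex _ 0 [set c | eR R c /\ a * c = e]); exists c.
Qed.

Lemma ele_total (a c : R) : eR R a -> eR R c -> ele a c || ele c a.
Proof.
move=> aR cR; rewrite /ele (addrC c).
case: (eqVneq a c) => [<-|ne]; last first.
  have ne' : e * a <> e * c by rewrite !eR_id //; apply/eqP.
  by case: (st_bipotent stR ne') => ->; rewrite eqxx ?orbT.
by rewrite (st_ghost stR (erefl (e * a))) eR_id // eqxx.
Qed.

Lemma emaxE (a c : R) : eR R a -> eR R c -> emax a c = a + c.
Proof.
move=> aR cR; rewrite /emax; have := ele_total aR cR.
rewrite /ele (addrC c).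
by case: ifP => [/eqP->|_ /= /eqP->].
Qed.

Lemma R_mul_neq0 (a c : R) : a <> 0 -> c <> 0 -> a * c <> 0.
Proof.
move=> a0 c0 ac0; apply: c0; apply: e_eq0.
have [_ inva] := einvP (eR_mule a) (fun h => a0 (e_eq0 h)).
by rewrite -inva mulrAC -(mulrA e) ac0 mulr0 mul0r.
Qed.

Lemma R_mulI (a c d : R) :
  a <> 0 -> eR R c -> eR R d -> a * c = a * d -> c = d.
Proof.
move=> a0 cR dR acd.
have [_ inva] := einvP (eR_mule a) (fun h => a0 (e_eq0 h)).
rewrite -(eR_id cR) -(eR_id dR) -inva.
by rewrite mulrAC -[e * a * c]mulrA acd mulrA mulrAC.
Qed.

Lemma q_neq0 (x : V) : x <> 0 -> q x <> 0.
Proof. by move=> x0 qx0; apply: x0; rewrite -[x = 0]/([set 0] x) -qan. Qed.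

Lemma ray_self (x : V) : x <> 0 -> ray x x.
Proof.
have one0 : (1 : R) <> 0.
  by move=> h; apply: sfR.1; rewrite -[e_of R]mulr1 h mulr0.
by move=> x0; split=> //; exists 1, 1.
Qed.

(* The value of CS on rays does not depend on the representatives. *)
Lemma CS_ray (x y : V) : x <> 0 -> y <> 0 ->
  CS q b (ray x) (ray y) = ediv (e * b x y ^+ 2) (e * (q x * q y)).
Proof.
move=> x0 y0; rewrite /CS.
have [x'0 [l [m [l0 m0 lx]]]] := xgetI 0 (ray_self x0).
have [y'0 [r [s [r0 s0 ry]]]] := xgetI 0 (ray_self y0).
move: (xget 0 (ray x)) (xget 0 (ray y)) x'0 y'0 lx ry => x' y' x'0 y'0 lx ry.
have qE : (l * r) ^+ 2 * (q x * q y) = (m * s) ^+ 2 * (q x' * q y').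
  by rewrite !exprMn [LHS]mulrACA [RHS]mulrACA -!(qp_scale qb) lx ry.
have bE : (l * r) * b x y = (m * s) * b x' y'.
  have bl a c u v : b (a *: u) (c *: v) = a * c * b u v.
    by rewrite (qp_scaleb qb) (qp_sym qb) (qp_scaleb qb) (qp_sym qb)
       mulrCA mulrA.
  by rewrite -!bl lx ry.
have sq0 (a : R) : a <> 0 -> a ^+ 2 <> 0 by move=> a0; exact: R_mul_neq0.
have Q0 : q x * q y <> 0 by apply: R_mul_neq0; apply: q_neq0.
have Q'0 : q x' * q y' <> 0 by apply: R_mul_neq0; apply: q_neq0.
have eR_div a c : eR R (ediv (e * a) c).
  by rewrite /ediv -mulrA; exact: eR_mule.
have divK a c : c <> 0 -> c * ediv (e * a) (e * c) = e * a.
  move=> c0; have [_ h] := einvP (eR_mule c) (fun h => c0 (e_eq0 h)).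
  rewrite /ediv mulrCA (mulrC e a) -[LHS]mulrA.
  by rewrite (mulrA e) h.
apply: (@R_mulI ((l * r) ^+ 2 * (q x * q y))) => //.
  by apply: R_mul_neq0 => //; apply: sq0; apply: R_mul_neq0.
rewrite {1}qE -[LHS]mulrA -[RHS]mulrA !divK //.
by rewrite mulrCA [RHS]mulrCA -!exprMn bE.
Qed.

Lemma qQL_sum (n : nat) (Y : 'I_n -> V) (l : {ffun 'I_n -> R}) :
  eV_base Y -> (forall i, eR R (l i)) ->
  qQL q Y (\sum_(i < n) l i *: Y i) = \sum_(i < n) l i ^+ 2 * q (Y i).
Proof.
move=> [YV bY] lR; set y := \sum_(i < n) _.
have yV : eV y.
  exists y => //; rewrite /y scaler_sumr; apply: eq_bigr => i _.
  by rewrite scalerA eR_id.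
have [l0 [_ l0u]] := bY y yV; rewrite /qQL.
suff -> : coords Y y = l by [].
have ly : decomposition Y y l by [].
by rewrite /coords -(l0u l ly) -(l0u _ (xgetI [ffun=> 0] ly)).
Qed.

End Theory.

(* Main.v *)
(* Squaring is additive on eR and e b(w, -) is linear, so with y the sum of the
   l_i y_i the numerator e b(w, y)^2 is the sum of the
   l_i^2 e b(w, y_i)^2 = q(w) l_i^2 q(y_i) CS(W, Y_i). Bounding every
   CS(W, Y_i) by the maximum leaves q(w) q_QL(y) times that maximum, and it
   remains to divide by q(w) q(y). *)
Require Import Defs.
Local Open Scope classical_set_scope.
Local Open Scope ring_scope.
Import GRing.Theory.

Section GhostIdeal.
Set Implicit Arguments.
Unset Strict Implicit.
Variable R : comPzSemiRingType.
Hypothesis stR : supertropical R.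
Local Notation e := (e_of R).

Lemma eR0 : eR R 0. Proof. by exists 0; rewrite ?mulr0. Qed.

Lemma eRD (a c : R) : eR R a -> eR R c -> eR R (a + c).
Proof. by case=> a' _ <- [c' _ <-]; exists (a' + c'); rewrite ?mulrDr. Qed.

Lemma eRMl (a c : R) : eR R c -> eR R (a * c).
Proof. by case=> c' _ <-; exists (a * c'); rewrite // mulrCA. Qed.

Lemma eR_sum (I : Type) (r : seq I) (F : I -> R) :
  (forall i, eR R (F i)) -> eR R (\sum_(i <- r) F i).
Proof. by move=> FR; elim/big_ind: _ => // [|a c]; [exact: eR0|exact: eRD]. Qed.

Lemma eR_addxx (a : R) : eR R a -> a + a = a.
Proof. by move=> aR; rewrite (st_ghost stR (erefl (e * a))) (eR_id stR aR). Qed.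

(** No cross term survives: if the ghosts [e * a] and [e * c] differ, [a + c] is one of the two
    terms and its square absorbs the other; if they agree, both sides equal [e * a ^+ 2]. *)
Lemma e_sqrD (a c : R) : e * (a + c) ^+ 2 = e * a ^+ 2 + e * c ^+ 2.
Proof.
(* Writing [u] as [u + v], the expanded square already contains [e * v ^+ 2], and addition on [eR]
   is idempotent. *)
have absorb (u v : R) : u + v = u -> e * u ^+ 2 + e * v ^+ 2 = e * u ^+ 2.
  move=> uv; rewrite -[in LHS]uv -[in RHS]uv sqrrD !mulrDr -addrA.
  by rewrite (eR_addxx (eR_mule (v ^+ 2))).
have [eac|/eqP neac] := eqVneq (e * a) (e * c).
  have sqe (u : R) : e * u ^+ 2 = (e * u) ^+ 2.
    by rewrite exprMn [e ^+ 2]expr2 (mulee stR).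
  rewrite (st_ghost stR eac) !sqe -eac mulrA (mulee stR) eR_addxx // expr2.
  by apply: eRMl; exact: eR_mule.
have [ac|ac] := st_bipotent stR neac; first by rewrite ac absorb.
by rewrite ac addrC absorb // addrC.
Qed.

Lemma e_sqr_sum (I : Type) (r : seq I) (F : I -> R) :
  e * (\sum_(i <- r) F i) ^+ 2 = \sum_(i <- r) e * F i ^+ 2.
Proof.
by apply: (big_morph (fun x => e * x ^+ 2) e_sqrD); rewrite expr0n mulr0.
Qed.

(** On [eR] the maximum is addition, and both have default 0; as a sum, the maximum obeys
    distributivity. *)
Lemma bigemax_sum (I : Type) (r : seq I) (F : I -> R) :
  (forall i, eR R (F i)) ->
  \big[@emax R/0]_(i <- r) F i = \sum_(i <- r) F i.
Proof.
move=> FR; elim: r => [|i r IH]; first by rewrite !big_nil.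
by rewrite !big_cons IH emaxE //; exact: eR_sum.
Qed.

(** With the sum read as a maximum, this says that each term is at most the maximum. *)
Lemma eR_sum_absorb (I : finType) (F : I -> R) (i : I) :
  (forall j, eR R (F j)) -> F i + \sum_j F j = \sum_j F j.
Proof. by move=> FR; rewrite (bigD1 i) //= addrA eR_addxx. Qed.

End GhostIdeal.

Section CauchySchwarz.
Set Implicit Arguments.
Unset Strict Implicit.
Variables (R : comPzSemiRingType) (V : lSemiModType R).
Variables (q : V -> R) (b : V -> V -> R).
Hypotheses (stR : supertropical R) (sfR : eR_semifield R).
Hypotheses (qb : quadratic_pair q b) (qan : anisotropic q).
Local Notation e := (e_of R).

Lemma polar_sum (n : nat) (x : V) (l : 'I_n -> R) (Y : 'I_n -> V) :
  b x (\sum_i l i *: Y i) = \sum_i l i * b x (Y i).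
Proof.
have b0 : b x 0 = 0 by rewrite -(scale0r 0) (qp_scaleb qb) mul0r.
rewrite (big_morph (b x) (qp_add qb x) b0).
by apply: eq_bigr => i _; rewrite (qp_scaleb qb).
Qed.

Lemma eR_q (x : V) : eV x -> eR R (q x).
Proof.
case=> v _ <-; exists (q v) => //.
by rewrite (qp_scale qb) expr2 (mulee stR).
Qed.

Lemma eR_CS (X Y : set V) : eR R (CS q b X Y).
Proof. by rewrite /CS /ediv -mulrA; exact: eR_mule. Qed.

(** Clears the denominator of [CS], which is nonzero by anisotropy and the absence of zero
    divisors. *)
Lemma CS_mulK (x y : V) : x <> 0 -> y <> 0 ->
  q x * q y * CS q b (ray x) (ray y) = e * b x y ^+ 2.
Proof.
move=> x0 y0; rewrite (CS_ray stR sfR qb qan) //.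
have Q0 : q x * q y <> 0.
  by apply: (R_mul_neq0 stR sfR); exact: (q_neq0 qan).
have [_ h] := einvP sfR (eR_mule _) (fun h => Q0 (e_eq0 stR h)).
by rewrite /ediv mulrCA (mulrC e) -[LHS]mulrA (mulrA e) h.
Qed.

(** Otherwise 0 would have two decompositions, the zero one and the one with coefficient [e] at [i],
    forcing [e = 0]. *)
Lemma eV_base_neq0 (n : nat) (Y : 'I_n -> V) (i : 'I_n) :
  eV_base Y -> Y i <> 0.
Proof.
move=> [YV bY] Yi0.
have [l [_ lu]] := bY 0 (ex_intro2 _ _ 0 I (scaler0 _ _)).
have l0 : l = [ffun=> 0].
  apply: lu; split=> [j|]; first by rewrite ffunE; exact: eR0.
  by rewrite big1 // => j _; rewrite ffunE scale0r.
have le : l = [ffun j => if j == i then e else 0].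
  apply: lu; split=> [j|].
    by rewrite ffunE; case: ifP => _; [exists 1; rewrite ?mulr1|exact: eR0].
  rewrite big1 // => j _; rewrite ffunE.
  by case: eqP => [->|_]; rewrite ?Yi0 ?scaler0 ?scale0r.
by apply: sfR.1; move: le; rewrite l0 => /ffunP/(_ i); rewrite !ffunE eqxx.
Qed.

End CauchySchwarz.

Theorem theorem8p4 (R : comPzSemiRingType) (V : lSemiModType R)
    (q : V -> R) (b : V -> V -> R)
    (stR : supertropical R) (sfR : eR_semifield R)
    (qb : quadratic_pair q b) (qan : anisotropic q)
    (n : nat) (Y : 'I_n -> V) (baseY : eV_base Y)
    (y : V) (yV : eV y) (y0 : y <> 0)
    (W : set V) (rayW : is_ray W) :
  ele (CS q b W (ray y))
      (ediv (qQL q Y y) (q y)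
       * \big[@emax R/0]_(i < n) CS q b W (ray (Y i))).
Proof.
have [w w0 ->] := rayW; have [l [[lR yE] _]] := baseY.2 y yV.
have qw0 := q_neq0 qan w0; have qy0 := q_neq0 qan y0.
have CSR X Z : eR R (CS q b X Z) by exact: eR_CS.
have CSsR := eR_sum (index_enum 'I_n) (fun i => CSR (ray w) (ray (Y i))).
rewrite bigemax_sum //; set M := \sum_i CS _ _ _ _ in CSsR *.
have [_ qyV] := einvP sfR (eR_q stR qb yV) qy0.
(* The order is the equation [a + c = c], so a nonzero common factor can be cancelled. *)
apply/eqP; apply: (@R_mulI _ stR sfR (q w * q y)).
- exact: (R_mul_neq0 stR sfR).
- by apply: eRD => //; exact: eRMl.
- exact: eRMl.
(* The product [q y * einv (q y)] is only [e], not 1; it disappears because [M] lies in [eR]. *)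
have rhsE : q w * q y * (ediv (qQL q Y y) (q y) * M)
    = \sum_i l i ^+ 2 * (q w * q (Y i)) * M.
  have -> : q w * q y * (ediv (qQL q Y y) (q y) * M)
      = q w * qQL q Y y * ((q y * einv (q y)) * M).
    by rewrite /ediv !mulrA (mulrAC (q w)).
  rewrite qyV (eR_id stR CSsR) {1}yE (qQL_sum q stR baseY lR).
  rewrite [q w * _]mulr_sumr mulr_suml.
  by apply: eq_bigr => i _; rewrite mulrCA.
rewrite mulrDr rhsE (CS_mulK stR sfR qb qan) // yE (polar_sum qb).
(* Both sides are now sums over the base, so the absorption is checked term by term. *)
rewrite (e_sqr_sum stR) -big_split; apply: eq_bigr => i _ /=.
have Yi0 := eV_base_neq0 sfR (i := i) baseY.
rewrite exprMn mulrCA -(CS_mulK stR sfR qb qan w0 Yi0) mulrA -mulrDr.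
by rewrite /M (eR_sum_absorb stR).
Qed.
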